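(* For $\beta>-1$ and integers $m\ge n\ge0$, writing $z_{m,n}$ for $z^{(\beta)}_{m,n}(z_1,z_2|q)$, $$q^{m+1+\beta}z_2\,z_{m+1,n}=-(1-q^{n+1})z_{m+1,n+1}+(1-q^{m+\beta+1})z_{m,n},$$ $$q^nz_1\,z_{m,n}=z_{m+1,n}-z_{m,n-1},$$ $$\big(1+q(1-q^n-q^{m+\beta})-z_1z_2q^{\beta+m+n+1}\big)z_{m,n}=(1-q^{1+n})z_{m+1,n+1}+q(1-q^{\beta+m})z_{m-1,n-1}.$$
   Context: $0<q<1$; $(a;q)_n=\prod_{k=0}^{n-1}(1-aq^k)$, $(a,b;q)_n=(a;q)_n(b;q)_n$. The $q$-Laguerre polynomials are $$L_n^{(\alpha)}(x;q)=(q^{\alpha+1};q)_n\sum_{k=0}^n\frac{q^{(\alpha+n-k)(n-k)}(-x)^{n-k}}{(q;q)_k(q,q^{\alpha+1};q)_{n-k}}.$$ For $\beta>-1$, $z^{(\beta)}_{m,n}(z_1,z_2|q)=z_1^{m-n}L_n^{(\beta+m-n)}(z_1z_2;q)$ if $m\ge n$, and $z^{(\beta)}_{m,n}(z_1,z_2|q)=z^{(\beta)}_{n,m}(z_2,z_1|q)$ if $m<n$; terms with a negative index are $0$. *)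

(* Defs.v *)
From HB Require Import structures.
From mathcomp Require Import all_boot all_order all_algebra.
From mathcomp Require Import reals exp complex.
Set Implicit Arguments.
Unset Strict Implicit.
Unset Printing Implicit Defensive.
Import Order.TTheory GRing.Theory Num.Theory.
Local Open Scope ring_scope.
Local Open Scope complex_scope.

Definition qpoch (R : comNzRingType) (a q : R) (n : nat) : R :=
  \prod_(k < n) (1 - a * q ^+ k).

Definition qpoch2 (R : comNzRingType) (a b q : R) (n : nat) : R :=
  qpoch a q n * qpoch b q n.

(* The q-Laguerre polynomial with real parameters q, alpha at a complex x.  The
   truncated subtraction n - k is exact because k <= n; the denominators are
   nonzero when 0 < q < 1 and -1 < alpha. *)
Definition qLaguerre (R : realType) (q alpha : R) (n : nat) (x : R[i]) : R[i] :=
  (qpoch (q `^ (alpha + 1)) q n)%:C *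
  \sum_(k < n.+1)
    (q `^ ((alpha + (n - k)%:R) * (n - k)%:R))%:C * (- x) ^+ (n - k) /
    (qpoch q q k * qpoch2 q (q `^ (alpha + 1)) q (n - k))%:C.

(* Only meaningful for n <= m: m - n is truncated otherwise. *)
Definition zpoly_le (R : realType) (q beta : R) (m n : nat) (z1 z2 : R[i])
    : R[i] :=
  z1 ^+ (m - n) * qLaguerre q (beta + (m - n)%:R) n (z1 * z2).

(* Integer indices, so that the terms with a negative index make sense (and
   vanish). *)
Definition zpoly (R : realType) (q beta : R) (m n : int) (z1 z2 : R[i])
    : R[i] :=
  match m, n with
  | Posz m, Posz n => if (n <= m)%N then zpoly_le q beta m n z1 z2
                      else zpoly_le q beta n m z2 z1
  | _, _ => 0
  end.

(* Main.v *)
Require Import Defs.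
From HB Require Import structures.
From mathcomp Require Import all_boot all_order all_algebra.
From mathcomp Require Import reals exp complex.
From mathcomp Require Import ring lra zify.
Set Implicit Arguments.
Unset Strict Implicit.
Unset Printing Implicit Defensive.
Import Order.TTheory GRing.Theory Num.Theory.
Local Open Scope ring_scope.
Local Open Scope complex_scope.

(** With b = q^alpha and t = -x, cancelling the prefactor (q^(alpha+1); q)_n
    against its denominators turns L_n^(alpha)(x; q) into a polynomial in t
    whose coefficients are polynomials in b:
    [[
      sum_j b^j q^(j^2) (b q^(j+1); q)_(n-j) / ((q; q)_(n-j) (q; q)_j) t^j.
    ]]
    Raising alpha by 1 is replacing b by b q.  In this form the two contiguous
    relations in alpha and n, [qLaguerre_poly_diff] and [qLaguerre_poly_shift],
    hold coefficient by coefficient, over any field in which no q^k with k > 0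
    equals 1: consecutive terms share all but one factor of each q-shifted
    factorial, and what remains is a polynomial identity in b and powers of q.

    Multiplied by the power z1^(m-n), and evaluated at t = - z1 z2 with
    b = q^(beta+m-n), these relations are the second and the first recurrence
    of the theorem ([zpoly_mulz1], [zpoly_mulz2]).  Here the power of z1 absorbs
    the change of m - n, and in the first recurrence the monomial t produced by
    the shift supplies both the factor z2 and the missing factor z1.

    The third recurrence is a consequence of the other two.  By the second, the
    product z1 z2 z_(m,n) is, up to a power of q, z2 z_(m+1,n) - z2 z_(m,n-1);
    the first recurrence, at (m, n) and at (m-1, n-1), expands both terms along
    the diagonal. *)

Lemma qpoch0 (R : comNzRingType) (a q : R) : qpoch a q 0 = 1.
Proof. by rewrite /qpoch big_ord0. Qed.

Lemma qpochSr (R : comNzRingType) (a q : R) n :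
  qpoch a q n.+1 = qpoch a q n * (1 - a * q ^+ n).
Proof. by rewrite /qpoch big_ord_recr. Qed.

Lemma qpochSl (R : comNzRingType) (a q : R) n :
  qpoch a q n.+1 = (1 - a) * qpoch (a * q) q n.
Proof.
rewrite /qpoch big_ord_recl expr0 mulr1; congr (_ * _).
by apply: eq_bigr => i _; rewrite /= /bump exprS mulrA.
Qed.

Lemma qpochD (R : comNzRingType) (a q : R) m n :
  qpoch a q (m + n) = qpoch a q m * qpoch (a * q ^+ m) q n.
Proof.
rewrite /qpoch big_split_ord /=; congr (_ * _).
by apply: eq_bigr => i _; rewrite exprD mulrA.
Qed.

Lemma qpoch_neq0 (F : fieldType) (a q : F) n :
  (forall k, 1 - a * q ^+ k != 0) -> qpoch a q n != 0.
Proof. by move=> nz; apply/prodf_neq0 => k _; apply: nz. Qed.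

Lemma rmorph_qpoch (R S : comNzRingType) (f : {rmorphism R -> S}) (a q : R) n :
  f (qpoch a q n) = qpoch (f a) (f q) n.
Proof.
rewrite /qpoch rmorph_prod; apply: eq_bigr => k _.
by rewrite rmorphB rmorph1 rmorphM rmorphXn.
Qed.

(** The coefficient of (-x)^j in the q-Laguerre polynomial with b = q^alpha,
    for j <= n.  The quotient (bq; q)_n / (bq; q)_j is written as the single
    factor (b q^(j+1); q)_(n-j), so that no condition on b is needed. *)
Definition qLaguerre_coef (F : fieldType) (q b : F) (n j : nat) : F :=
  b ^+ j * q ^+ (j * j) * qpoch (b * q ^+ j.+1) q (n - j)
  / (qpoch q q (n - j) * qpoch q q j).

Definition qLaguerre_poly (F : fieldType) (q b : F) (n : nat) : {poly F} :=
  \poly_(j < n.+1) qLaguerre_coef q b n j.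

Section Contiguous.
Variables (F : fieldType) (q : F).
Hypothesis q_nonroot : forall k, 1 - q * q ^+ k != 0.

Lemma qLaguerre_poly_degree0 (b : F) : qLaguerre_poly q b 0 = 1.
Proof.
apply/polyP => j; rewrite coef_poly coef1 /qLaguerre_coef.
by case: j => [|j] //=; rewrite !qpoch0 !expr0 !mulr1 divr1.
Qed.

(** In degree j, with N = n + 1, c = b q^(j+1) and k = N - j > 0, all terms
    share (c q; q)_(k-1), and what remains is q^k (1 - c) = (1 - c q^k) - (1 - q^k).
    This is q^N L_N^(alpha) = L_N^(alpha+1) - L_(N-1)^(alpha+1). *)
Lemma qLaguerre_poly_diff (b : F) (n : nat) :
  q ^+ n.+1 *: qLaguerre_poly q b n.+1
  = qLaguerre_poly q (b * q) n.+1 - qLaguerre_poly q (b * q) n.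
Proof.
apply/polyP => j; rewrite coefZ coefB !coef_poly /qLaguerre_coef.
have nzj : qpoch q q j != 0 by exact: qpoch_neq0.
case: (ltngtP j n.+1) => [lt_jn|lt_nj|->].
- have [k ->] : exists k, n = (j + k)%N by exists (n - j)%N; lia.
  have -> : (j < (j + k).+2)%N by lia.
  rewrite -addnS !addKn.
  have nzk : qpoch q q k != 0 by exact: qpoch_neq0.
  have nzS := q_nonroot k.
  rewrite qpochSl !qpochSr.
  have -> : b * q * q ^+ j.+1 = b * q ^+ j.+1 * q by ring.
  rewrite !exprMn addnS !exprS exprD; field.
  by rewrite nzk nzj nzS.
- by rewrite ltnS leqNgt lt_nj /= mulr0 subr0.
- have nzn : qpoch q q n.+1 != 0 by exact: qpoch_neq0.
  by rewrite ltnSn subnn subr0 !qpoch0 exprMn; field; rewrite nzn.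
Qed.

(** The factor 'X compensates the shift of alpha, so that in degree j + 1 all
    terms share (b q^(j+2); q)_(n-j), and what remains is
    (1 - q^(n+1)) - (1 - q^(n-j)) = q^(n-j) (1 - q^(j+1)).
    This is the relation
    q^(alpha+n+1) x L_n^(alpha+1)
    = - (1 - q^(n+1)) L_(n+1)^(alpha) + (1 - q^(alpha+n+1)) L_n^(alpha);
    the sign on the left comes from 'X standing for -x. *)
Lemma qLaguerre_poly_shift (b : F) (n : nat) :
  - (b * q ^+ n.+1) *: ('X * qLaguerre_poly q (b * q) n)
  = - (1 - q ^+ n.+1) *: qLaguerre_poly q b n.+1
    + (1 - b * q ^+ n.+1) *: qLaguerre_poly q b n.
Proof.
apply/polyP => j; rewrite coefZ coefD !coefZ coefXM !coef_poly /qLaguerre_coef.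
case: j => [|j] /=.
  rewrite !qpoch0 !subn0 !expr0 !qpochSr mulr0.
  have nzn : qpoch q q n != 0 by exact: qpoch_neq0.
  have nzS := q_nonroot n.
  by rewrite !exprS; field; rewrite nzn nzS.
rewrite !ltnS subSS.
have nzj : qpoch q q j != 0 by exact: qpoch_neq0.
have nzSj := q_nonroot j.
case: (ltngtP j n) => [lt_jn|lt_nj|->].
- have [k ->] : exists k, n = (j + k.+1)%N by exists (n - j.+1)%N; lia.
  rewrite addKn addnS subSS addKn.
  have nzk : qpoch q q k != 0 by exact: qpoch_neq0.
  have nzS := q_nonroot k.
  have -> : b * q * q ^+ j.+1 = b * q ^+ j.+2 by rewrite !exprS; ring.
  rewrite !qpochSr exprMn.
  (* Expanding the exponent leaves powers with atomic exponents for field. *)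
  have -> : (j.+1 * j.+1 = j * j + j + j.+1)%N by lia.
  rewrite !(exprS, exprD); field.
  by rewrite nzk nzj nzSj nzS.
- by rewrite !mulr0 addr0.
- rewrite subnn !qpoch0 qpochSr mulr0 addr0 exprMn.
  have -> : (n.+1 * n.+1 = n * n + n + n.+1)%N by lia.
  have nzn : qpoch q q n != 0 by exact: qpoch_neq0.
  have nzS := q_nonroot n.
  rewrite !(exprS, exprD); field.
  by rewrite nzn nzS.
Qed.

End Contiguous.

Section RealParameters.
Variables (R : realType) (q : R).
Hypotheses (q_gt0 : 0 < q) (q_lt1 : q < 1).

Lemma powR_add (r s : R) : q `^ (r + s) = q `^ r * q `^ s.
Proof. by rewrite powRD// (gt_eqF q_gt0) implybT. Qed.

Lemma qpoch_lt1_neq0 (a : R) n : a < 1 -> 0 <= a -> qpoch a q n != 0.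
Proof.
move=> a_lt1 a_ge0; apply: qpoch_neq0 => k; rewrite subr_eq0 eq_sym lt_eqF//.
apply: le_lt_trans a_lt1; rewrite ler_piMr// exprn_ile1//; exact: ltW.
Qed.

(** The hypothesis on alpha makes q^(alpha+1) < 1, so that the factors
    (q^(alpha+1); q)_j in the denominators may be cancelled. *)
Lemma qLaguerreE (alpha : R) (n : nat) (x : R[i]) : -1 < alpha ->
  qLaguerre q alpha n x = (qLaguerre_poly q%:C (q `^ alpha)%:C n).[- x].
Proof.
move=> alpha_gtN1; rewrite horner_poly /qLaguerre mulr_sumr.
rewrite (reindex_inj rev_ord_inj) /=; apply: eq_bigr => j _.
have le_jn : (j <= n)%N by rewrite -ltnS.
rewrite subSS subKn //.
have powS : q `^ (alpha + 1) = q `^ alpha * q.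
  by rewrite powR_add powRr1// ltW.
have pow_lt1 : q `^ (alpha + 1) < 1.
  rewrite -[ltRHS](congr1 (@^~ (alpha + 1)) (powR1 R)).
  by apply: gt0_ltr_powR; rewrite ?nnegrE ?ltW//; lra.
have nzn : qpoch q q (n - j) != 0 by exact/qpoch_lt1_neq0/ltW.
have nzj : qpoch q q j != 0 by exact/qpoch_lt1_neq0/ltW.
have nza : qpoch (q `^ (alpha + 1)) q j != 0 by exact/qpoch_lt1_neq0/powR_ge0.
have -> : qLaguerre_coef q%:C (q `^ alpha)%:C n j
        = (qLaguerre_coef q (q `^ alpha) n j)%:C.
  by rewrite /qLaguerre_coef !(rmorph_qpoch, rmorphM, rmorphXn, fmorphV).
rewrite mulrA mulrAC mulrA -!(rmorphM, fmorphV); congr (_%:C * _).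
rewrite /qLaguerre_coef /qpoch2 powRrM powR_mulrn ?powR_ge0//.
rewrite (powR_add alpha j%:R) powR_mulrn ?ltW// exprMn -exprM.
rewrite -[in qpoch _ q n](subnKC le_jn) qpochD.
have -> : q `^ alpha * q ^+ j.+1 = q `^ (alpha + 1) * q ^+ j.
  by rewrite powS exprS mulrA.
by field; rewrite nzn nzj nza.
Qed.

Variables (beta : R) (z1 z2 : R[i]).
Hypothesis beta_gtN1 : -1 < beta.

Lemma zpolyE (m n : nat) : (n <= m)%N ->
  zpoly q beta m n z1 z2
  = z1 ^+ (m - n)
    * (qLaguerre_poly q%:C ((q `^ beta)%:C * q%:C ^+ (m - n)) n).[- (z1 * z2)].
Proof.
move=> le_nm; rewrite /zpoly le_nm /zpoly_le qLaguerreE; last first.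
  by apply: lt_le_trans beta_gtN1 _; rewrite lerDl.
by rewrite powR_add powR_mulrn ?ltW// rmorphM rmorphXn.
Qed.

Lemma real_q_nonroot k : 1 - q%:C * q%:C ^+ k != 0.
Proof.
rewrite -exprS -rmorphXn -(rmorph1 (real_complex R)) -rmorphB fmorph_eq0.
by rewrite subr_eq0 eq_sym lt_eqF// exprn_ilt1// ltW.
Qed.

Lemma zpoly_mulz1 (m n : nat) : (n.+1 <= m)%N ->
  q%:C ^+ n.+1 * z1 * zpoly q beta m n.+1 z1 z2
  = zpoly q beta m.+1 n.+1 z1 z2 - zpoly q beta m n z1 z2.
Proof.
move=> lt_nm; rewrite !zpolyE ?(leqW lt_nm) ?(ltnW lt_nm)//.
have [d ->] : exists d, m = (n.+1 + d)%N by exists (m - n.+1)%N; lia.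
rewrite subSS addSnnS !addKn -addSnnS addKn.
have := qLaguerre_poly_diff real_q_nonroot ((q `^ beta)%:C * q%:C ^+ d) n.
rewrite -[_ * q%:C]mulrA -exprSr.
move/(congr1 (horner^~ (- (z1 * z2)))); rewrite hornerZ hornerD hornerN => E.
rewrite -mulrBr -{}E (exprS z1); ring.
Qed.

Lemma zpoly_mulz1_0 (m : nat) :
  z1 * zpoly q beta m 0 z1 z2 = zpoly q beta m.+1 0 z1 z2.
Proof. by rewrite !zpolyE// !qLaguerre_poly_degree0 !subn0 !mulrA exprS. Qed.

Lemma zpoly_mulz2 (m n : nat) : (n <= m)%N ->
  (q `^ beta)%:C * q%:C ^+ m.+1 * z2 * zpoly q beta m.+1 n z1 z2
  = - (1 - q%:C ^+ n.+1) * zpoly q beta m.+1 n.+1 z1 z2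
    + (1 - (q `^ beta)%:C * q%:C ^+ m.+1) * zpoly q beta m n z1 z2.
Proof.
move=> le_nm; rewrite !zpolyE ?(leqW le_nm)//.
have [d ->] : exists d, m = (n + d)%N by exists (m - n)%N; lia.
rewrite subSS -addnS !addKn.
have := qLaguerre_poly_shift real_q_nonroot ((q `^ beta)%:C * q%:C ^+ d) n.
rewrite -[_ * q%:C]mulrA -exprSr -[_ * q%:C ^+ n.+1]mulrA -exprD addnS.
move/(congr1 (horner^~ (- (z1 * z2)))).
rewrite hornerZ hornerD !hornerZ hornerM hornerX => E.
rewrite !(mulrCA _ (z1 ^+ d)) -mulrDr (addnC n) addSn -{}E (exprS z1); ring.
Qed.

End RealParameters.

Theorem theorem5p2 (R : realType) (q beta : R) (z1 z2 : R[i]) (m n : nat)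
    (q_gt0 : 0 < q) (q_lt1 : q < 1) (beta_gtN1 : -1 < beta)
    (le_nm : (n <= m)%N) :
  let z (i j : int) : R[i] := zpoly q beta i j z1 z2 in
  [/\ (q `^ (m%:R + 1 + beta))%:C * z2 * z (m%:Z + 1) n%:Z
      = - (1 - q ^+ (n + 1))%:C * z (m%:Z + 1) (n%:Z + 1)
        + (1 - q `^ (m%:R + beta + 1))%:C * z m%:Z n%:Z,
      (q ^+ n)%:C * z1 * z m%:Z n%:Z
      = z (m%:Z + 1) n%:Z - z m%:Z (n%:Z - 1)
    & ((1 + q * (1 - q ^+ n - q `^ (m%:R + beta)))%:C
         - z1 * z2 * (q `^ (beta + m%:R + n%:R + 1))%:C) * z m%:Z n%:Z
      = (1 - q ^+ (1 + n))%:C * z (m%:Z + 1) (n%:Z + 1)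
        + (q * (1 - q `^ (beta + m%:R)))%:C * z (m%:Z - 1) (n%:Z - 1)].
Proof.
move=> z.
have powD k : q `^ (beta + k%:R) = q `^ beta * q ^+ k.
  by rewrite powR_add// powR_mulrn// ltW.
have -> : m%:R + 1 + beta = beta + m.+1%:R by rewrite -natr1; ring.
have -> : m%:R + beta + 1 = beta + m.+1%:R by rewrite -natr1; ring.
have -> : beta + m%:R + n%:R + 1 = beta + (m + n).+1%:R.
  by rewrite -natr1 natrD; ring.
rewrite (addrC m%:R beta) !powD addn1 add1n.
have predz k : (k.+1%:Z - 1 = k)%R by lia.
have succz k : (k%:Z + 1 = k.+1)%R by lia.
rewrite !succz !(rmorphB, rmorphD, rmorphM, rmorphXn, rmorph1).
have H1 : (q `^ beta)%:C * q%:C ^+ m.+1 * z2 * z m.+1 n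
        = - (1 - q%:C ^+ n.+1) * z m.+1 n.+1
          + (1 - (q `^ beta)%:C * q%:C ^+ m.+1) * z m n.
  exact: zpoly_mulz2.
have H2 : q%:C ^+ n * z1 * z m n = z m.+1 n - z m (n%:Z - 1).
  (* For n = 0 the term with index -1 vanishes. *)
  case: n le_nm {H1} => [|n] le_nm.
    by rewrite mul1r zpoly_mulz1_0// /z sub0r subr0.
  by rewrite predz; apply: zpoly_mulz1.
split=> //.
(* The first recurrence at (m - 1, n - 1).  It persists for n = 0, where the
   factor 1 - q ^+ n vanishes together with the terms of negative index. *)
have H3 : (q `^ beta)%:C * q%:C ^+ m * z2 * z m (n%:Z - 1)
        = - (1 - q%:C ^+ n) * z m n
          + (1 - (q `^ beta)%:C * q%:C ^+ m) * z (m%:Z - 1) (n%:Z - 1).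
  case: n le_nm {H1 H2} => [|n] le_nm.
    have zN1 i : z i (0%:Z - 1) = 0 by rewrite /z sub0r; case: i.
    by rewrite !zN1 expr0 subrr oppr0 mul0r !mulr0 addr0.
  case: m le_nm => // m le_nm; rewrite !predz; exact: zpoly_mulz2.
(* The second recurrence, multiplied by q^(beta+m+1) z2, trades z1 z2 z_(m,n)
   for the left-hand sides of H1 and H3. *)
transitivity ((1 + q%:C * (1 - q%:C ^+ n - (q `^ beta)%:C * q%:C ^+ m)) * z m n
  - ((q `^ beta)%:C * q%:C ^+ m.+1 * z2 * z m.+1 n
     - q%:C * ((q `^ beta)%:C * q%:C ^+ m * z2 * z m (n%:Z - 1)))).
  rewrite -[z m.+1 n](subrK (z m (n%:Z - 1))) -H2 !exprS exprD; ring.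
by rewrite H1 H3 !exprS; ring.
Qed.
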